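(* Let $R$ be a ring and $G$ a locally solvable group. Then the group ring $RG$ is a $U\sqrt{\Delta}$-ring if and only if $R$ is a $U\sqrt{\Delta}$-ring and $G$ is a locally finite $p$-group for a prime $p\in J(R)$.
   Context: All rings are associative with identity. $RG$ denotes the group ring of $G$ over $R$. $J(R)$ is the Jacobson radical of $R$ (the intersection of all maximal left ideals of $R$); ''$p\in J(R)$'' means $p\cdot 1_R\in J(R)$. A $p$-group is a group in which every element has order a power of $p$. A group is locally finite (resp. locally solvable) if every finitely generated subgroup is finite (resp. solvable). For a ring $R$, $U(R)$ is its group of units, $\Delta(R)=\{x\in R \mid x+u\in U(R)\text{ for all }u\in U(R)\}$, and $\sqrt{\Delta(R)}=\{x\in R\mid x^n\in\Delta(R)\text{ for some } n\in\mathbb{N}\}$, where $\mathbb{N}$ is the set of positive integers. A ring $R$ is a $U\sqrt{\Delta}$-ring if every non-unit $a\in R$ can be written as $a=ub$ with $u\in U(R)$ and $b\in\sqrt{\Delta(R)}$.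
   Formalization: The group G is assumed nontrivial and the ring R nonzero: for G = 1 and R = Q the group ring RG = Q is a U√Δ-ring but no prime lies in J(Q) = 0, and for R = 0 the claim fails for G = Z. *)

(* Defs.v *)
From HB Require Import structures.
From mathcomp Require Import all_boot all_algebra.
From mathcomp Require Import classical_sets cardinality.
From mathcomp Require Import finmap.
From mathcomp.multinomials Require Import monalg.

Set Implicit Arguments.
Unset Strict Implicit.
Unset Printing Implicit Defensive.

Import GRing.Theory.
Local Open Scope classical_set_scope.
Local Open Scope ring_scope.

(** The group ring.  Its additive group is the one of [{malg R[G]}], the
    finitely supported functions from [G] to [R].  The ring structure that the
    library puts on [{malg R[M]}] is only available for monoids [M] in which
    [x * y = 1] implies [x = y = 1], so the convolution product is redefined
    for groups, on an alias. *)

Definition group_ring (R : nzRingType) (G : groupType) : Type := {malg R[G]}.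

HB.instance Definition _ (R : nzRingType) (G : groupType) :=
  GRing.Zmodule.copy (group_ring R G) {malg R[G]}.

Section GroupRing.
Variables (R : nzRingType) (G : groupType).
Implicit Types (x y z : {malg R[G]}) (g h : G) (c : R).

Definition gr_one : {malg R[G]} := << 1 *g 1%g >>.

Definition gr_mul x y : {malg R[G]} :=
  \sum_(g <- msupp x) \sum_(h <- msupp y) << x@_g * y@_h *g (g * h)%g >>.

Lemma gr_mulw (d1 d2 : {fset G}) x y :
    (msupp x `<=` d1)%fset -> (msupp y `<=` d2)%fset ->
  gr_mul x y = \sum_(g <- d1) \sum_(h <- d2) << x@_g * y@_h *g (g * h)%g >>.
Proof.
move=> le1 le2; rewrite /gr_mul (big_fset_incl _ le1) /=.
  apply/eq_bigr => g _; apply/big_fset_incl => // h _ /mcoeff_outdom ->.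
  by rewrite mulr0 monalgU0.
move=> g _ /mcoeff_outdom xg.
by rewrite big1 // => h _; rewrite xg mul0r monalgU0.
Qed.

Lemma gr_mulDl : left_distributive gr_mul +%R.
Proof.
move=> x y z; pose d := (msupp x `|` msupp y)%fset.
rewrite (@gr_mulw d (msupp z) (x + y)) ?msuppD_le ?fsubset_refl //.
rewrite (@gr_mulw d (msupp z) x) ?fsubsetUl ?fsubset_refl //.
rewrite (@gr_mulw d (msupp z) y) ?fsubsetUr ?fsubset_refl //.
rewrite -big_split /=; apply/eq_bigr => g _.
rewrite -big_split /=; apply/eq_bigr => h _.
by rewrite mcoeffD mulrDl monalgUD.
Qed.

Lemma gr_mulDr : right_distributive gr_mul +%R.
Proof.
move=> z x y; pose d := (msupp x `|` msupp y)%fset.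
rewrite (@gr_mulw (msupp z) d z (x + y)) ?msuppD_le ?fsubset_refl //.
rewrite (@gr_mulw (msupp z) d z x) ?fsubsetUl ?fsubset_refl //.
rewrite (@gr_mulw (msupp z) d z y) ?fsubsetUr ?fsubset_refl //.
rewrite -big_split /=; apply/eq_bigr => g _.
rewrite -big_split /=; apply/eq_bigr => h _.
by rewrite mcoeffD mulrDr monalgUD.
Qed.

Lemma gr_mul0l x : gr_mul 0 x = 0.
Proof. by apply: (addIr (gr_mul 0 x)); rewrite -gr_mulDl !add0r. Qed.

Lemma gr_mul0r x : gr_mul x 0 = 0.
Proof. by apply: (addIr (gr_mul x 0)); rewrite -gr_mulDr !add0r. Qed.

Lemma gr_mulUU c1 c2 g1 g2 :
  gr_mul << c1 *g g1 >> << c2 *g g2 >> = << c1 * c2 *g (g1 * g2)%g >>.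
Proof. by rewrite (gr_mulw msuppU_le msuppU_le) !big_seq_fset1 !mcoeffUU. Qed.

Lemma gr_mul_suml (I : Type) (r : seq I) (F : I -> {malg R[G]}) x :
  gr_mul (\sum_(i <- r) F i) x = \sum_(i <- r) gr_mul (F i) x.
Proof. exact: (big_morph (gr_mul^~ x) (fun y z => gr_mulDl y z x) (gr_mul0l x)). Qed.

Lemma gr_mul_sumr (I : Type) (r : seq I) (F : I -> {malg R[G]}) x :
  gr_mul x (\sum_(i <- r) F i) = \sum_(i <- r) gr_mul x (F i).
Proof. exact: (big_morph (gr_mul x) (fun y z => gr_mulDr x y z) (gr_mul0r x)). Qed.

Lemma gr_mul1l : left_id gr_one gr_mul.
Proof.
move=> x; rewrite {1}[x]monalgE gr_mul_sumr [RHS]monalgE.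
by apply/eq_bigr => g _; rewrite gr_mulUU mul1r mul1g.
Qed.

Lemma gr_mul1r : right_id gr_one gr_mul.
Proof.
move=> x; rewrite {1}[x]monalgE gr_mul_suml [RHS]monalgE.
by apply/eq_bigr => g _; rewrite gr_mulUU mulr1 mulg1.
Qed.

Lemma gr_mulA : associative gr_mul.
Proof.
move=> x y z; rewrite [x]monalgE [y]monalgE [z]monalgE.
rewrite !gr_mul_suml; apply/eq_bigr => g _.
rewrite [LHS]gr_mul_sumr [in RHS](gr_mul_sumr _ _ << x@_g *g g >>).
rewrite [RHS]gr_mul_suml; apply/eq_bigr => h _.
rewrite !gr_mul_sumr; apply/eq_bigr => k _.
by rewrite !gr_mulUU mulrA mulgA.
Qed.

Lemma gr_one_neq0 : gr_one != 0.
Proof.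
by apply/eqP => /malgP /(_ 1%g) /eqP; rewrite mcoeffUU mcoeff0 oner_eq0.
Qed.

HB.instance Definition _ := GRing.Zmodule_isNzRing.Build (group_ring R G)
  gr_mulA gr_mul1l gr_mul1r gr_mulDl gr_mulDr gr_one_neq0.

End GroupRing.

Section Rings.
Variable R : nzRingType.
Implicit Types (a b u x y : R) (I M : set R).

(** [GRing.unit] is only available on [unitRingType]s, whose units are
    decidable; here [R] is an arbitrary ring. *)
Definition units : set R := [set u | exists v, u * v = 1 /\ v * u = 1].

Definition left_ideal I :=
  [/\ I 0, forall x y, I x -> I y -> I (x + y)
    & forall a x, I x -> I (a * x)].

Definition maximal_left_ideal M :=
  [/\ left_ideal M, M <> setT
    & forall I, left_ideal I -> M `<=` I -> I = M \/ I = setT].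

Definition jacobson_radical : set R := \bigcap_(M in maximal_left_ideal) M.

Definition Delta : set R := [set x | forall u, units u -> units (x + u)].

Definition sqrt_Delta : set R := [set x | exists2 n, (0 < n)%N & Delta (x ^+ n)].

Definition UsqrtDelta_ring :=
  forall a, ~ units a ->
  exists u b, [/\ units u, sqrt_Delta b & a = u * b].

End Rings.

Arguments units : clear implicits.
Arguments jacobson_radical : clear implicits.
Arguments Delta : clear implicits.
Arguments sqrt_Delta : clear implicits.
Arguments UsqrtDelta_ring : clear implicits.

Section Groups.
Local Open Scope group_scope.
(** [G] may be infinite, so the theory of [finGroupType] does not apply. *)
Variable G : groupType.
Implicit Types (g : G) (n p : nat) (A H : set G).

Definition subgroup H := H 1 /\ forall x y, H x -> H y -> H (x * y^-1).

Definition generated A : set G := smallest subgroup A.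

Definition derived H : set G := generated [set [~ x, y] | x in H & y in H].

(** The derived series of [H] reaches the trivial subgroup. *)
Definition solvable_subgroup H := exists n, iter n derived H = [set 1].

Definition locally_solvable :=
  forall A, finite_set A -> solvable_subgroup (generated A).

Definition locally_finite :=
  forall A, finite_set A -> finite_set (generated A).

Definition has_order g n :=
  [/\ (0 < n)%N, g ^+ n = 1 & forall m, (0 < m)%N -> g ^+ m = 1 -> (n <= m)%N].

Definition pgroup p := forall g, exists k, has_order g (p ^ k)%N.

End Groups.

Arguments locally_solvable : clear implicits.
Arguments locally_finite : clear implicits.
Arguments pgroup : clear implicits.

(* Main.v *)
From HB Require Import structures.
Require Import Defs.
From mathcomp Require Import all_boot all_algebra.
From mathcomp Require Import classical_sets boolp cardinality.
From mathcomp Require Import finmap.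
From mathcomp.multinomials Require Import monalg.

(** Both directions rest on one property: every element of the group ring with
    augmentation [1] is a unit.

    Suppose that the group ring is a [UsqrtDelta_ring].  In such a ring [1 + K]
    consists of units for every proper ideal [K] ([ideal_quasiregular]); the
    kernel of the augmentation gives the property.  The same fact in [R], which
    is a [UsqrtDelta_ring] as a retract of the group ring, puts every non-unit
    integer in the Jacobson radical and allows at most one prime to be a
    non-unit.  If [g] had infinite order, [1 - g + g ^ 2] could not be a unit,
    as its inverse would have infinitely many coefficients
    ([torsion_of_aug1_units]); and if [h ^ q = 1] with [h <> 1], then [q] is not
    a unit of [R], because [h - 1] kills [1 + h + ... + h ^ (q - 1)]
    ([nonunit_order]).  So [G] is a [p]-group with [p] in the radical, and it is
    locally finite because finitely generated solvable torsion groups are finite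
    ([torsion_solvable_finite]).

    Conversely, once the property is known, units, [Delta] and the
    decompositions lift from [R] along the augmentation
    ([UsqrtDelta_ring_group_ring]).  To prove it for an element [x] with
    augmentation [1], let [H] be the finite [p]-group generated by its support.
    If [x] were not left invertible in [R[H]], it would lie in a maximal left
    ideal [L].  The simple module [R[H]/L] is finitely generated over [R], so
    Nakayama's lemma shows that [p] kills it ([max_submod_nat]).  A solvable
    [p]-group has a nonzero fixed vector there ([fixed_by_solvable]), and since
    [R] commutes with [H] the fixed vectors form a submodule; hence [H] acts
    trivially, [x] is congruent to its augmentation [1] modulo [L], and [x]
    cannot be in [L] ([left_inverse_of_aug1]). *)

Set Implicit Arguments.
Unset Strict Implicit.
Unset Printing Implicit Defensive.

Import GRing.Theory.
Local Open Scope classical_set_scope.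
Local Open Scope ring_scope.

(** * Left ideals, units and ideals of rings *)

(** The left ideals of the subring [T], except that [L] may leave [T]: the
    group ring of a subgroup is then handled inside the whole group ring.
    For [T = setT] these are the left ideals. *)
Definition left_submod (S : nzRingType) (T L : set S) :=
  [/\ L 0, forall x y, L x -> L y -> L (x + y)
    & forall a x, T a -> L x -> L (a * x)].

(** Zorn's lemma.  Maximality is among the submodules that miss [1], so a
    submodule of [S] strictly larger than [L] contains [1]. *)
Lemma max_left_submod (S : nzRingType) (T L0 : set S) :
    left_submod T L0 -> ~ L0 1 ->
  exists L, [/\ left_submod T L, L0 `<=` L, ~ L 1
    & forall L', left_submod T L' -> L `<=` L' -> ~ L' 1 -> L' `<=` L].
Proof.
move=> L0sub L01.
(* Adding [L0] to every set makes the empty chain bounded. *)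
pose P A := left_submod T (A `|` L0) /\ ~ (A `|` L0) 1.
have [F FP Ftot|A [[Asub A1] Amax]] := @Zorn_bigcup S P.
  have inF x y : (\bigcup_(X in F) X `|` L0) x ->
      (\bigcup_(X in F) X `|` L0) y ->
      exists X, [/\ P X, X `<=` \bigcup_(X in F) X, (X `|` L0) x
                  & (X `|` L0) y].
    have PX X : F X -> X `<=` \bigcup_(X in F) X by move=> FX z Xz; exists X.
    move=> [[X FX Xx]|L0x] [[Y FY Yy]|L0y].
    - have [XY|YX] := Ftot _ _ FX FY; [exists Y|exists X].
        by split; [exact: FP|exact: PX|left; exact: XY|left].
      by split; [exact: FP|exact: PX|left|left; exact: YX].
    - by exists X; split; [exact: FP|exact: PX|left|right].
    - by exists Y; split; [exact: FP|exact: PX|right|left].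
    - by exists set0; split; rewrite /P ?set0U.
  split; last first.
    by move=> F1; have [X [[_ PX1] _ X1 _]] := inF _ _ F1 F1.
  split; first by right; case: L0sub.
    move=> x y Fx Fy; have [X [[[_ XD _] _] XF Xx Xy]] := inF _ _ Fx Fy.
    by case: (XD _ _ Xx Xy) => [/XF|]; [left|right].
  move=> a x Ta Fx; have [X [[[_ _ XM] _] XF Xx _]] := inF _ _ Fx Fx.
  by case: (XM _ _ Ta Xx) => [/XF|]; [left|right].
exists (A `|` L0); split=> // L' L'sub AL' L'1.
have L'E : L' `|` L0 = L' by apply/setUidPl => x L0x; apply: AL'; right.
have L'P : P L' by rewrite /P L'E.
have AsubL' : A `<=` L' by move=> x Ax; apply: AL'; left.
have [->|AneL'] := pselect (A = L'); first by left.
case: (Amax L') => //; rewrite properEneq; split => //; exact/eqP.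
Qed.

(** If no left multiple of [1 - r * x] is [1], a maximal left ideal contains it and
    cannot contain [x]; conversely a maximal left ideal [M] without [x] has
    [M + R x = R], which writes [1 - r * x] as an element of [M]. *)
Lemma jacobsonP (R : nzRingType) (x : R) :
  jacobson_radical R x <-> forall r, exists s, s * (1 - r * x) = 1.
Proof.
split=> [Jx r|xqr M [[M0 MD MM] MT Mmax]].
  apply: contrapT => nos; pose L0 := [set y | exists s, y = s * (1 - r * x)].
  have L0sub : left_submod setT L0.
    split; first by exists 0; rewrite mul0r.
      by move=> _ _ [s ->] [t ->]; exists (s + t); rewrite mulrDl.
    by move=> a _ _ [s ->]; exists (a * s); rewrite mulrA.
  have [|L [[L0' LD LM] L0L L1 Lmax]] := max_left_submod L0sub.
    by case=> s s1; apply: nos; exists s.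
  have Lx : L x.
    apply: Jx; split; first by split=> // a y; exact: LM.
      by move=> LT; apply: L1; rewrite LT.
    move=> I [I0 ID IM] LI; have [I1|I1] := pselect (I 1).
      by right; apply/seteqP; split=> // y _; rewrite -[y]mulr1; exact: IM.
    left; apply/seteqP; split=> //; apply: Lmax => //; split=> // a y _.
    exact: IM.
  apply: L1; rewrite -[1](subrK (r * x)); apply: LD; last exact: LM.
  by apply: L0L; exists 1; rewrite mul1r.
pose I := [set y | exists r, M (y - r * x)].
have Isub : left_ideal I.
  split; first by exists 0; rewrite mul0r subr0.
    move=> y z [r Mr] [s Ms]; exists (r + s).
    by rewrite mulrDl opprD addrACA; exact: MD.
  by move=> a y [r Mr]; exists (a * r); rewrite -mulrA -mulrBr; exact: MM.
have MI : M `<=` I by move=> y My; exists 0; rewrite mul0r subr0.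
case: (Mmax I Isub MI) => IE; first by rewrite -IE; exists 1; rewrite mul1r subrr.
have [r Mr] : I 1 by rewrite IE.
have [s s1] := xqr r; case: MT; apply/seteqP; split=> // y _.
by rewrite -[y]mulr1 -s1 mulrA; exact: MM.
Qed.

Section Units.
Variable S : nzRingType.
Implicit Types (u v x y d : S) (K : set S).

Lemma unitsM u v : units S u -> units S v -> units S (u * v).
Proof.
move=> [u' [uu' u'u]] [v' [vv' v'v]]; exists (v' * u'); split.
  by rewrite mulrA -(mulrA u) vv' mulr1.
by rewrite mulrA -(mulrA v') u'u mulr1.
Qed.

Lemma unitsX u n : units S u -> units S (u ^+ n).
Proof.
move=> uu; elim: n => [|n IHn]; first by exists 1; rewrite mulr1.
by rewrite exprS; exact: unitsM.
Qed.

Lemma unitsN u : units S u -> units S (- u).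
Proof. by move=> [v [uv vu]]; exists (- v); rewrite !mulrNN. Qed.

(** If [1 + k = u * b] were a non-unit, then modulo [K] the element [b] would
    be [u^-1], so that [b ^+ n - u^-n] would lie in [K]; but it is a unit,
    being a unit added to an element of [Delta S]. *)
Lemma ideal_quasiregular K k :
    UsqrtDelta_ring S -> K 0 -> (forall x y, K x -> K y -> K (x - y)) ->
    (forall a x, K x -> K (a * x)) -> (forall x a, K x -> K (x * a)) -> ~ K 1 ->
  K k -> units S (1 + k).
Proof.
move=> SU K0 KB KL KR K1 Kk; apply: contrapT => k1.
(* [v] is the inverse of [u]. *)
have [u [b [[v [uv vu]] [n n_gt0 bn] kub]]] := SU _ k1.
have Kvb : K (b - v).
  have -> : b - v = v * k.
    by rewrite -[b]mul1r -vu -mulrA -kub mulrDr mulr1 addrC addKr.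
  exact: KL.
have Kvbn m : K (b ^+ m - v ^+ m).
  elim: m => [|m IHm]; first by rewrite subrr.
  have -> : b ^+ m.+1 - v ^+ m.+1
      = b * (b ^+ m - v ^+ m) - (v - b) * v ^+ m.
    by rewrite !exprS mulrBr mulrBl opprB addrA subrK.
  apply: (KB _ _ (KL _ _ IHm)); apply: KR.
  by have := KB _ _ K0 Kvb; rewrite sub0r opprB.
have vn : units S (v ^+ n) by apply: unitsX; exists u.
have [w [_ wbv]] := bn _ (unitsN vn).
by apply: K1; rewrite -wbv; apply: KL.
Qed.

End Units.

(** The multiples of the central element [q] form a proper two-sided ideal. *)
Lemma nonunit_nat_quasiregular (R : nzRingType) (q : nat) :
    UsqrtDelta_ring R -> ~ units R q%:R ->
  forall r, units R (1 + q%:R * r).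
Proof.
move=> RU nq r; pose K := [set y : R | exists r, y = q%:R * r].
apply: (@ideal_quasiregular _ K) => //.
- by exists 0; rewrite mulr0.
- by move=> _ _ [s ->] [t ->]; exists (s - t); rewrite mulrBr.
- by move=> a _ [s ->]; exists (a * s); rewrite !mulrA (commr_nat a).
- by move=> _ a [s ->]; exists (s * a); rewrite mulrA.
- by move=> [s qs]; apply: nq; exists s; split=> //; rewrite (commr_nat s).
by exists r.
Qed.

Lemma jacobson_nonunit_nat (R : nzRingType) (q : nat) :
  UsqrtDelta_ring R -> ~ units R q%:R -> jacobson_radical R q%:R.
Proof.
move=> RU nq; apply/jacobsonP => r.
have [s [_ s1]] := nonunit_nat_quasiregular RU nq (- r).
by exists s; rewrite (commr_nat r) -mulrN.
Qed.

(** For distinct primes a Bezout relation gives [q * km = 1 + p * kn], a unit. *)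
Lemma nonunit_primes_eq (R : nzRingType) (p q : nat) :
    UsqrtDelta_ring R -> prime p -> prime q ->
  ~ units R p%:R -> ~ units R q%:R -> p = q.
Proof.
move=> RU p_pr q_pr np nq; apply/eqP/negPn/negP => pq.
have [km kn kE _] := egcdnP p (prime_gt0 q_pr).
have : coprime q p by rewrite prime_coprime // dvdn_prime2 // eq_sym.
move=> /eqP cqp; rewrite cqp in kE.
have [s [s1 _]] := nonunit_nat_quasiregular RU np kn%:R.
have qkm : 1 + p%:R * kn%:R = q%:R * km%:R :> R.
  by rewrite -!natrM mulnC [(q * km)%N]mulnC kE natrD addrC.
rewrite qkm in s1; apply: nq; exists (km%:R * s).
by rewrite commr_nat mulrA.
Qed.

Lemma exprD1n_prime (S : nzRingType) (t : S) (p : nat) : prime p ->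
  (t + 1) ^+ p
    = t ^+ p + 1 + (\sum_(i < p.-1) t ^+ i.+1 *+ ('C(p, i.+1) %/ p)) *+ p.
Proof.
move=> p_pr; rewrite exprD1n -sumrMnl.
under [in RHS]eq_bigr => i _.
  rewrite -mulrnA divnK; last first.
    by apply: prime_dvd_bin => //=; rewrite -ltn_predRL.
  over.
case: p p_pr => // p _; rewrite big_ord_recl big_ord_recr /= expr0 bin0 binn.
by rewrite [LHS]addrC [RHS]addrAC; congr (_ + _); rewrite addrC.
Qed.

(** * The group ring and its augmentation *)

Section GroupRingTheory.
Variables (R : nzRingType) (G : groupType).
Implicit Types (x y : group_ring R G) (g h : G) (c d : R).

Definition gr c g : group_ring R G := << c *g g >>.
(** [mcoeff] and [mmap] retyped on the group ring, whose multiplication the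
    types of the library functions do not carry. *)
Definition coef g x : R := mcoeff g x.
Definition aug x : R := mmap idfun (fun=> 1) x.

Lemma gr1 : gr 1 1%g = 1. Proof. by []. Qed.

Lemma gr0 g : gr 0 g = 0. Proof. exact: monalgU0. Qed.

Lemma grD c d g : gr (c + d) g = gr c g + gr d g.
Proof. exact: monalgUD. Qed.

Lemma grN c g : gr (- c) g = - gr c g.
Proof. exact: monalgUN. Qed.

Lemma grMn c g n : gr (c *+ n) g = gr c g *+ n.
Proof. exact: monalgUMn. Qed.

Lemma grM c d g h : gr c g * gr d h = gr (c * d) (g * h)%g.
Proof. exact: gr_mulUU. Qed.

Lemma grX g n : gr 1 g ^+ n = gr 1 (g ^+ n)%g.
Proof.
elim: n => [|n IHn]; first by rewrite expr0 expg0.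
by rewrite exprS IHn grM mulr1 expgS.
Qed.

Lemma gr_sum x : x = \sum_(g <- msupp x) gr (coef g x) g.
Proof. exact: monalgE. Qed.

Lemma gr_ind (P : group_ring R G -> Prop) x :
    P 0 -> (forall x y, P x -> P y -> P (x + y)) ->
    (forall g, coef g x != 0 -> P (gr (coef g x) g)) -> P x.
Proof.
move=> P0 PD PU; rewrite [x]gr_sum big_seq; apply: big_ind => // g.
by rewrite -mcoeff_neq0; exact: PU.
Qed.

Lemma coef_is_additive g : zmod_morphism (coef g).
Proof. exact: mcoeffB. Qed.
HB.instance Definition _ g :=
  GRing.isZmodMorphism.Build (group_ring R G) R (coef g) (coef_is_additive g).

Lemma coef_gr c g h : coef h (gr c g) = c *+ (g == h).
Proof. exact: mcoeffU. Qed.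

Lemma coef_grM c g h x : coef h (gr c g * x) = c * coef (g^-1 * h)%g x.
Proof.
rewrite {1 2}[x]gr_sum mulr_sumr !raddf_sum mulr_sumr.
apply: eq_bigr => k _; rewrite grM /= !coef_gr -mulrnAr.
by congr (_ * (_ *+ nat_of_bool _)); apply/eqP/eqP => [<-|->];
  rewrite ?mulKg ?mulVKg.
Qed.

Lemma aug_is_additive : zmod_morphism aug.
Proof. exact: mmapB. Qed.
HB.instance Definition _ :=
  GRing.isZmodMorphism.Build (group_ring R G) R aug aug_is_additive.

Lemma aug_gr c g : aug (gr c g) = c.
Proof. by rewrite /aug mmapU mulr1. Qed.

Lemma aug_is_monoid_morphism : monoid_morphism aug.
Proof.
split; first by rewrite -gr1 aug_gr.
move=> x y; rewrite [x]gr_sum [y]gr_sum (mulr_suml (msupp x)) !raddf_sum.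
rewrite mulr_suml /=; apply: eq_bigr => g _; rewrite !mulr_sumr raddf_sum /=.
by apply: eq_bigr => h _; rewrite grM !aug_gr.
Qed.
HB.instance Definition _ :=
  GRing.isMonoidMorphism.Build (group_ring R G) R aug aug_is_monoid_morphism.

Lemma units_gr c : units R c -> units (group_ring R G) (gr c 1%g).
Proof.
by move=> [d [cd dc]]; exists (gr d 1%g); rewrite !grM mulg1 cd dc.
Qed.

Lemma units_aug x : units _ x -> units R (aug x).
Proof.
by move=> [y [xy yx]]; exists (aug y); rewrite -!rmorphM xy yx rmorph1.
Qed.

(** Units of [R] are units of the group ring, and [aug] maps units to units. *)
Lemma Delta_aug x : Delta _ x -> Delta R (aug x).
Proof.
move=> Dx u uu; rewrite -(aug_gr u 1%g) -rmorphD.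
by apply/units_aug/Dx/units_gr.
Qed.

(** A non-unit of [R] stays a non-unit in the group ring, because [aug] would
    carry an inverse back; [aug] also carries back its decomposition. *)
Lemma UsqrtDelta_ring_coef :
  UsqrtDelta_ring (group_ring R G) -> UsqrtDelta_ring R.
Proof.
move=> SU a na; have [|u [b [uu [n n_gt0 bn] aub]]] := SU (gr a 1%g).
  by move=> /units_aug; rewrite aug_gr.
exists (aug u), (aug b); split; first exact: units_aug.
  by exists n => //; rewrite -rmorphXn; exact: Delta_aug.
by rewrite -rmorphM -aub /= aug_gr.
Qed.

Lemma units_of_aug1 :
  (forall x, aug x = 1 -> units _ x) -> forall x, units R (aug x) -> units _ x.
Proof.
move=> aug1 x [v [xv vx]].
have <- : gr (aug x) 1%g * (gr v 1%g * x) = x.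
  by rewrite mulrA grM xv mulg1 gr1 mul1r.
apply: unitsM; first by apply: units_gr; exists v.
by apply: aug1; rewrite rmorphM /= aug_gr.
Qed.

(** When invertibility can be tested after [aug], non-units, units and
    [Delta] all correspond along [aug]; a decomposition [aug x = u * b] lifts
    to [x = u * (u^-1 * x)]. *)
Lemma UsqrtDelta_ring_group_ring :
    (forall x, aug x = 1 -> units _ x) -> UsqrtDelta_ring R ->
  UsqrtDelta_ring (group_ring R G).
Proof.
move=> aug1 RU x nx; have [|u [b [uu [n n_gt0 bn] xub]]] := RU (aug x).
  by move=> /(units_of_aug1 aug1).
have [v [uv vu]] := uu.
exists (gr u 1%g), (gr v 1%g * x); split; first exact: units_gr.
  exists n => // w /units_aug uw; apply: units_of_aug1 => //.
  rewrite rmorphD rmorphXn rmorphM /= aug_gr xub mulrA vu mul1r; exact: bn.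
by rewrite mulrA grM uv mulg1 gr1 mul1r.
Qed.

(** The kernel of [aug] is a proper ideal. *)
Lemma unit_of_aug1_UsqrtDelta x :
  UsqrtDelta_ring (group_ring R G) -> aug x = 1 -> units _ x.
Proof.
move=> SU x1; rewrite -[x](subrK 1) addrC.
pose K := [set y | aug y = 0].
apply: (@ideal_quasiregular _ K) => //; rewrite /K /=.
- exact: rmorph0.
- by move=> y z y0 z0; rewrite rmorphB /= y0 z0 subrr.
- by move=> a y y0; rewrite rmorphM /= y0 mulr0.
- by move=> y a y0; rewrite rmorphM /= y0 mul0r.
- by rewrite rmorph1; apply/eqP/oner_neq0.
- by rewrite rmorphB /= x1 rmorph1 subrr.
Qed.

End GroupRingTheory.

(** * Finitely generated torsion groups *)

Section GroupTheory.
Local Open Scope group_scope.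
Variable G : groupType.
Implicit Types (g h a : G) (A B D H K T : set G).

Lemma subgroupV H g : subgroup H -> H g -> H g^-1.
Proof. by move=> [H1 HM] Hg; rewrite -[_^-1]mul1g; exact: HM. Qed.

Lemma subgroupM H g h : subgroup H -> H g -> H h -> H (g * h).
Proof.
by move=> sH Hg Hh; rewrite -[h]invgK; apply: sH.2 => //; exact: subgroupV.
Qed.

Lemma subgroupX H g n : subgroup H -> H g -> H (g ^+ n).
Proof.
move=> sH Hg; elim: n => [|n IHn]; first by rewrite expg0; case: sH.
by rewrite expgS; exact: subgroupM.
Qed.

Lemma subgroup_comm H g h : subgroup H -> H g -> H h -> H [~ g, h].
Proof.
move=> sH Hg Hh; rewrite commgEl conjgE.
by do !apply: subgroupM => //; apply: subgroupV.
Qed.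

Lemma subgroup_generated A : subgroup (generated A).
Proof.
split=> [|x y Ax Ay] K [sK AK]; first by case: sK.
by apply: sK.2; [exact: Ax|exact: Ay].
Qed.

Lemma sub_generated A : A `<=` generated A.
Proof. by move=> x Ax K [_]; apply. Qed.

Lemma generated_min A H : subgroup H -> A `<=` H -> generated A `<=` H.
Proof. by move=> sH AH x; apply. Qed.

Lemma derived_sub H : subgroup H -> derived H `<=` H.
Proof.
move=> sH; apply: generated_min => // _ [x Hx [y Hy <-]].
exact: subgroup_comm.
Qed.

Lemma derived_comm H g h : H g -> H h -> derived H [~ g, h].
Proof. by move=> Hg Hh; apply: sub_generated; exists g => //; exists h. Qed.

Definition covers T K H :=
  forall h, H h -> exists t k, [/\ T t, K k & h = t * k].

(** Schreier's lemma: subgroups of finite index in a finitely generated group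
    are finitely generated.  Since [T] need not be a transversal, the
    generators of [K] are all the elements of [K] among the
    [t'^-1 * a * t] and the [t]; they generate a subgroup [<B>] such that
    [T <B>] is stable under the generators of the big group. *)
Lemma finite_index_generated A K T :
    finite_set A -> finite_set T -> subgroup K -> K `<=` generated A ->
    T `<=` generated A -> covers T K (generated A) ->
  exists2 B, finite_set B & K = generated B.
Proof.
move=> Afin Tfin sK KH TH TK; have sH := subgroup_generated A.
pose A1 := A `|` [set a^-1 | a in A].
pose C := [set x.1.1^-1 * x.1.2 * x.2 | x in T `*` A1 `*` T].
pose B := K `&` (C `|` T).
have Cfin : finite_set C.
  apply: finite_image; do !apply: finite_setX => //.
  by rewrite /A1 finite_setU; split=> //; exact: finite_image.
exists B; first by apply: finite_setIr; rewrite finite_setU.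
have sB := subgroup_generated B.
have BK : generated B `<=` K by apply: generated_min => // x [].
apply/seteqP; split=> //.
pose Q := [set q | exists t b, [/\ T t, generated B b & q = t * b]].
have QA1 a q : A1 a -> Q q -> Q (a * q).
  move=> A1a [t [b [Tt Bb ->]]]; have Ha : generated A a.
    case: A1a => [/sub_generated //|[a' Aa' <-]].
    by apply: (subgroupV sH); exact: sub_generated.
  have [t' [k [Tt' Kk atE]]] := TK _ (subgroupM sH Ha (TH _ Tt)).
  exists t', (k * b); split=> //; last by rewrite !mulgA atE.
  apply: (subgroupM sB) => //; apply: sub_generated; split=> //; left.
  by exists ((t', a), t) => //=; rewrite -mulgA atE mulKg.
have HQ : generated A `<=` [set h | forall q, Q q -> Q (h * q) /\ Q (h^-1 * q)].
  apply: generated_min.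
    split=> [q Qq|x y xQ yQ q Qq]; first by rewrite invg1 !mul1g.
    have [[_ xq] [_ yq]] := (xQ _ Qq, yQ _ Qq).
    by rewrite invgF -!mulgA; split; [case: (xQ _ yq)|case: (yQ _ xq)].
  move=> a Aa q Qq; split; apply: QA1 => //; first by left.
  by right; exists a.
have TB t : T t -> K t -> generated B t.
  by move=> Tt Kt; apply: sub_generated; split=> //; right.
have Q1 : Q 1.
  have [t [k [Tt Kk tk]]] := TK _ sH.1; exists t, t^-1; split=> //.
    apply: (subgroupV sB); apply: TB => //.
    have -> : t = k^-1 by apply/eqP; rewrite -mulg_eq1 -tk.
    exact: (subgroupV sK).
  by rewrite mulgV.
move=> k Kk; have [[t [b [Tt Bb kE]]] _] := HQ _ (KH _ Kk) _ Q1.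
rewrite mulg1 in kE; rewrite kE; apply: (subgroupM sB) => //; apply: TB => //.
by rewrite -(mulgK b t) -kE; apply: sK.2 => //; exact: BK.
Qed.

Hypothesis Gtorsion : forall g : G, exists2 n, (0 < n)%N & g ^+ n = 1.

Lemma torsion_inv_pow g n : exists m, g ^- n = g ^+ m.
Proof.
have [m m_gt0 gm] := Gtorsion g; exists (n * m.-1)%N.
apply/esym/eqP; rewrite -mulg_eq1 -expgnDr addnC -mulnS prednK //.
by rewrite mulnC expgnA gm expg1n.
Qed.

(** [K' = <a> K] is a subgroup because [K] contains the commutators; only the
    powers of [a] below its order are needed to cover it. *)
Lemma extend_by_torsion H K T a : subgroup H -> H a -> subgroup K -> K `<=` H ->
    derived H `<=` K -> finite_set T -> T `<=` H -> covers T (derived H) K ->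
  exists K' T', [/\ subgroup K', K' `<=` H, K `<=` K' /\ K' a,
    finite_set T' /\ T' `<=` H & covers T' (derived H) K'].
Proof.
move=> sH Ha sK KH DK Tfin TH TK.
have [m m_gt0 am] := Gtorsion a.
pose K' := [set x | exists e k, K k /\ x = a ^+ e * k].
exists K', [set a ^+ x.1 * x.2 | x in `I_m `*` T]; split.
- split; first by exists 0%N, 1; split; [case: sK|rewrite expg0 mulg1].
  move=> _ _ [e [k [Kk ->]]] [f [l [Kl ->]]].
  have [f' f'E] := torsion_inv_pow a f.
  exists (e + f')%N, (k * l^-1 * [~ k * l^-1, a ^+ f']).
  have Kkl : K (k * l^-1) by apply: sK.2.
  split; last first.
    have := commgC (k * l^-1) (a ^+ f'); rewrite invgM f'E expgnDr -!mulgA => ->.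
    by rewrite !mulgA.
  apply: (subgroupM sK) => //; apply: DK; apply: derived_comm; first exact: KH.
  exact: (subgroupX _ sH).
- move=> _ [e [k [Kk ->]]]; apply: (subgroupM sH); last exact: KH.
  exact: (subgroupX _ sH).
- split; first by move=> k Kk; exists 0%N, k; rewrite expg0 mul1g.
  by exists 1%N, 1; split; [case: sK|rewrite expg1 mulg1].
- split; first by apply: finite_image; exact: finite_setX.
  move=> _ [[e t] [/= _ Tt] <-]; apply: (subgroupM sH); last exact: TH.
  exact: (subgroupX _ sH).
move=> _ [e [k [Kk ->]]]; have [t [d [Tt Dd ->]]] := TK _ Kk.
exists (a ^+ (e %% m) * t), d; split=> //; last first.
  rewrite {1}(divn_eq e m) expgnDr mulnC expgnA am expg1n mul1g.
  by rewrite !mulgA.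
by exists ((e %% m)%N, t) => //; split=> //=; rewrite ltn_mod.
Qed.

(** The finitely many generators are added to the derived subgroup one at a
    time, each enlarging it by a finite index. *)
Lemma abelianization_finite A : finite_set A ->
  exists T, [/\ finite_set T, T `<=` generated A
    & covers T (derived (generated A)) (generated A)].
Proof.
move=> /finite_seqP [s ->]; set H := generated _.
have sH : subgroup H by exact: subgroup_generated.
suff [K [T [[sK KH] [DK sK'] Tfin TH TK]]] : exists K T,
    [/\ subgroup K /\ K `<=` H, derived H `<=` K /\ [set` s] `<=` K,
      finite_set T, T `<=` H & covers T (derived H) K].
  by exists T; split=> // h Hh; apply: TK; move: h Hh; exact: generated_min.
have sub_s : [set` s] `<=` H by exact: sub_generated.
elim: (s) sub_s => [_|a r IHr ar].
  exists (derived H), [set 1]; split=> //.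
  - by split; [exact: subgroup_generated|exact: derived_sub].
  - by split=> // x; rewrite /= in_nil.
  - by move=> _ ->; case: sH.
  by move=> h Dh; exists 1, h; rewrite mul1g.
have [|K [T [[sK KH] [DK rK] Tfin TH TK]]] := IHr.
  by move=> x xr; apply: ar; rewrite /= inE; apply/orP; right.
have Ha : H a by apply: ar; rewrite /= inE eqxx.
have [K' [T' [sK' KH' [KK' Ka] [Tfin' TH'] TK']]] :=
  extend_by_torsion sH Ha sK KH DK Tfin TH TK.
exists K', T'; split=> //; split; first exact: subset_trans KK'.
by move=> x; rewrite /= inE => /orP[/eqP -> //|/rK/KK'].
Qed.

(** Induction on the derived length: the derived subgroup has finite index,
    hence is again finitely generated. *)
Lemma torsion_solvable_finite A :
  finite_set A -> solvable_subgroup (generated A) -> finite_set (generated A).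
Proof.
move=> Afin [n]; elim: n A Afin => [|n IHn] A Afin.
  by move=> /= ->; exact: finite_set1.
have sH := subgroup_generated A.
rewrite iterSr => Dn.
have [T [Tfin TH TD]] := abelianization_finite Afin.
have [B Bfin DB] := finite_index_generated (K := derived _) Afin Tfin
  (subgroup_generated _) (derived_sub sH) TH TD.
have Dfin : finite_set (derived (generated A)).
  by rewrite DB; apply: IHn => //; rewrite -DB.
apply: (@sub_finite_set _ _ [set x.1 * x.2 | x in T `*` derived (generated A)]).
  by move=> h /TD [t [d [Tt Dd ->]]]; exists (t, d).
by apply: finite_image; exact: finite_setX.
Qed.

End GroupTheory.

Lemma has_order_pgroup (G : groupType) (p : nat) : prime p ->
    (forall g : G, exists2 n, (0 < n)%N & (g ^+ n = 1)%g) ->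
    (forall (h : G) q, prime q -> h <> 1%g -> (h ^+ q = 1)%g -> q = p) ->
  pgroup G p.
Proof.
move=> p_pr tor orderp g.
have exn : exists n, (0 < n)%N && (g ^+ n == 1)%g.
  by have [n n0 /eqP gn] := tor g; exists n; rewrite n0.
case: (ex_minnP exn) => m /andP[m0 /eqP gm] mmin.
have mp : p.-nat m.
  apply/pnatP => // q q_pr qm; rewrite inE; apply/eqP.
  apply: (orderp (g ^+ (m %/ q))%g) => //; last by rewrite -expgnA divnK.
  move=> gmq; have := mmin (m %/ q)%N.
  rewrite gmq eqxx andbT divn_gt0 ?prime_gt0 // dvdn_leq // => /(_ isT).
  by rewrite leqNgt ltn_Pdiv ?prime_gt1.
exists (logn p m); split; rewrite -?p_part ?part_pnat_id //.
by move=> n n0 /eqP gn; apply: mmin; rewrite n0.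
Qed.

(** * Groups for which augmentation one implies invertible *)

Section AugmentationOneUnits.
Variables (R : nzRingType) (G : groupType).
Hypothesis aug1_units : forall x : group_ring R G, aug x = 1 -> units _ x.
Implicit Types (x y : group_ring R G) (g h : G).

(** If [q * v = 1], then [N * v] with [N = 1 + h + ... + h ^ (q - 1)] has
    augmentation [1], so it is a unit; but [(h - 1) * N = 0]. *)
Lemma nonunit_order h q : h <> 1%g -> (h ^+ q = 1)%g -> ~ units R q%:R.
Proof.
move=> h1 hq [v [qv _]].
pose N : group_ring R G := \sum_(i < q) gr 1 h ^+ i.
have [|w [Nw _]] := aug1_units (x := N * gr v 1%g).
  rewrite rmorphM /= aug_gr rmorph_sum /= -[RHS]qv; congr (_ * _).
  under eq_bigr do rewrite grX aug_gr.
  by rewrite sumr_const card_ord.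
have /eqP : (gr 1 h - 1 : group_ring R G) = 0.
  have hN : (gr 1 h - 1) * N = 0 by rewrite -subrX1 grX hq gr1 subrr.
  by rewrite -[LHS]mulr1 -[X in _ * X]Nw !mulrA hN !mul0r.
rewrite subr_eq0 -gr1 => /eqP/(congr1 (coef h)).
have -> : coef h (gr 1 1%g) = 0 :> R.
  by rewrite coef_gr; case: eqP => // e; case: h1.
by rewrite coef_gr eqxx => /eqP; rewrite oner_eq0.
Qed.

(** The recurrence has period 6, so a nonzero [coef y x] would recur at
    infinitely many elements of the support of [x]. *)
Lemma periodic_coef_eq0 g (y : G) x :
    (forall n, (0 < n)%N -> (g ^+ n <> 1)%g) ->
    (forall j, coef (g ^+ j.+2 * y)%g x
             = coef (g ^+ j.+1 * y)%g x - coef (g ^+ j * y)%g x) ->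
  coef y x = 0.
Proof.
move=> ginf rec; pose c j := coef (g ^+ j * y)%g x.
have c6 j : c j.+3.+3 = c j.
  have c3 i : c i.+3 = - c i by rewrite /c !rec addrAC subrr sub0r.
  by rewrite !c3 opprK.
have c6M k : c (k * 6)%N = c 0%N.
  by elim: k => [|k IHk]; rewrite ?mul0n // mulSn addnC !addnS addn0 c6.
apply/eqP/negPn/negP => cy.
pose s := [seq (g ^+ (k * 6) * y)%g | k <- iota 0 (size (msupp x)).+1].
have : (size s <= size (msupp x))%N.
  apply: uniq_leq_size; last first.
    move=> _ /mapP [k _ ->]; rewrite -mcoeff_neq0.
    by have := c6M k; rewrite /c expg0 mul1g /coef => ->.
  rewrite map_inj_uniq ?iota_uniq // => i j /mulIg.
  wlog ij : i j / (i <= j)%N => [wl|].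
    by case: (leqP i j) => [|/ltnW]; [exact: wl|move=> ji /esym /wl -> //].
  move=> /esym gij; apply/eqP; rewrite eqn_leq ij leqNgt; apply/negP => ltij.
  case: (ginf ((j - i) * 6)%N); first by rewrite muln_gt0 subn_gt0 ltij.
  by rewrite mulnBl expgnFr ?leq_mul2r ?ij ?orbT // gij mulgV.
by rewrite size_map size_iota ltnn.
Qed.

(** If [g] had infinite order, [1 - g + g ^ 2] would be a unit.  The
    coefficients of its inverse along the powers of [g] satisfy the recurrence
    of period 6 on both sides of [1], so they vanish at [g^-2], [g^-1] and [1];
    these are the only ones entering the coefficient of the product at [1]. *)
Lemma torsion_of_aug1_units g : exists2 n, (0 < n)%N & (g ^+ n = 1)%g.
Proof.
apply: contrapT => notor.
have ginf n : (0 < n)%N -> (g ^+ n <> 1)%g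
  by move=> n0 gn; apply: notor; exists n.
pose a : group_ring R G := 1 - gr 1 g + gr 1 (g ^+ 2)%g.
have [|x [ax _]] := aug1_units (x := a).
  by rewrite rmorphD rmorphB rmorph1 /= !aug_gr subrr add0r.
have ec k : coef k x - coef (g^-1 * k)%g x + coef (g^-1 * (g^-1 * k))%g x
    = (1%g == k)%:R.
  rewrite -coef_gr gr1 -ax !mulrDl mulNr mul1r.
  by rewrite !(raddfD, raddfN) /= !coef_grM !mul1r expg2 invgM mulgA.
have ec0 k : k != 1%g ->
    coef k x - coef (g^-1 * k)%g x + coef (g^-1 * (g^-1 * k))%g x = 0.
  by rewrite eq_sym => /negPf k1; rewrite ec k1.
have recr k : k != 1%g ->
    coef k x = coef (g^-1 * k)%g x - coef (g^-1 * (g^-1 * k))%g x.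
  by move=> /ec0/eqP; rewrite addrAC subr_eq0 => /eqP <-; rewrite addrK.
have recl k : k != 1%g ->
    coef (g^-1 * (g^-1 * k))%g x = coef (g^-1 * k)%g x - coef k x.
  by move=> /ec0/eqP; rewrite addrC addr_eq0 opprB => /eqP.
have c1 : coef g^-1%g x = 0.
  apply: (periodic_coef_eq0 ginf) => j; rewrite recr.
    by rewrite ![(g ^+ _.+1)%g]expgS -!mulgA !mulKg.
  by rewrite expgSr mulgK; apply/eqP/ginf.
have c0 : coef 1%g x = 0.
  apply: (periodic_coef_eq0 ginf) => j; rewrite recr.
    by rewrite ![(g ^+ _.+1)%g]expgS -!mulgA !mulKg.
  by rewrite mulg1; apply/eqP/ginf.
have Vginf n : (0 < n)%N -> (g^-1 ^+ n <> 1)%g.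
  by move=> n0; rewrite expVgn => /eqP; rewrite invg_eq1 => /eqP; exact: ginf.
have c2 : coef (g^-1 ^+ 2)%g x = 0.
  apply: (periodic_coef_eq0 Vginf) => j.
  rewrite ![(_ ^+ j.+2)%g]expgS ![(_ ^+ j.+1)%g]expgS -!mulgA recl //.
  by rewrite -expgnDr; apply/eqP/Vginf; rewrite addn2.
have := ec 1%g; rewrite mulg1 -expg2 c0 c1 c2 eqxx subr0 addr0 => /esym/eqP.
by rewrite oner_eq0.
Qed.

End AugmentationOneUnits.

Lemma UsqrtDelta_group_ring_necessary (R : nzRingType) (G : groupType) :
    (exists g : G, g <> 1%g) -> locally_solvable G ->
    UsqrtDelta_ring (group_ring R G) ->
  UsqrtDelta_ring R /\ exists p : nat,
     [/\ prime p, jacobson_radical R (p%:R), locally_finite G & pgroup G p].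
Proof.
move=> [g g1] Gsol SU; have RU := UsqrtDelta_ring_coef SU; split=> //.
have aug1 x : aug x = 1 -> units (group_ring R G) x :=
  unit_of_aug1_UsqrtDelta SU (x:=x).
have tor := torsion_of_aug1_units aug1.
(* A prime [p] is found as the order of a power of [g]. *)
have [h [p [p_pr h1 hp]]] :
    exists (h : G) p, [/\ prime p, h <> 1%g & (h ^+ p = 1)%g].
  have [n n0 gn] := tor g; elim/ltn_ind: n g g1 n0 gn => n IHn g g1 n0 gn.
  have n1 : (1 < n)%N by case: n n0 gn {IHn} => [|[|]] // _; rewrite expg1.
  have [gq|gq] := eqVneq (g ^+ (pdiv n))%g 1%g.
    by exists g, (pdiv n); split=> //; exact: pdiv_prime.
  apply: (IHn (n %/ pdiv n)%N _ (g ^+ pdiv n)%g) => //.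
  - by rewrite ltn_Pdiv // prime_gt1 ?pdiv_prime.
  - exact/eqP.
  - by rewrite divn_gt0 ?pdiv_gt0 // dvdn_leq // pdiv_dvd.
  by rewrite -expgnA mulnC divnK // pdiv_dvd.
have np := nonunit_order aug1 h1 hp.
exists p; split=> //; first exact: jacobson_nonunit_nat.
  by move=> A Afin; apply: (torsion_solvable_finite tor Afin); exact: Gsol.
apply: has_order_pgroup => // k q q_pr k1 kq.
exact: (nonunit_primes_eq RU q_pr p_pr (nonunit_order aug1 k1 kq) np).
Qed.

(** * Group rings of locally finite p-groups *)

Section SubgroupRing.
Variables (R : nzRingType) (G : groupType) (H : set G).
Hypothesis sH : subgroup H.
Implicit Types (x y : group_ring R G) (g h : G) (c : R).

Definition supported : set (group_ring R G) :=
  [set x | forall g, coef g x != 0 -> H g].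

Lemma supported0 : supported 0.
Proof. by move=> g; rewrite raddf0 eqxx. Qed.

Lemma supportedD x y : supported x -> supported y -> supported (x + y).
Proof.
move=> Hx Hy g; rewrite raddfD /=; have [x0|/Hx //] := eqVneq (coef g x) 0.
by rewrite x0 add0r; exact: Hy.
Qed.

Lemma supported_gr c g : H g -> supported (gr c g).
Proof.
by move=> Hg h; rewrite coef_gr; case: (g =P h) => [<- //|_]; rewrite mulr0n eqxx.
Qed.

Lemma supported_ind (P : group_ring R G -> Prop) x :
    P 0 -> (forall x y, P x -> P y -> P (x + y)) ->
    (forall c g, H g -> P (gr c g)) -> supported x -> P x.
Proof. by move=> P0 PD PU Hx; apply: gr_ind => // g /Hx; exact: PU. Qed.

Lemma supportedM x y : supported x -> supported y -> supported (x * y).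
Proof.
move=> Hx Hy; move: Hx; apply: (@supported_ind (fun z => supported (z * y))).
- by rewrite mul0r; exact: supported0.
- by move=> x1 x2 H1 H2; rewrite mulrDl; exact: supportedD.
move=> c g Hg h; rewrite coef_grM => ch.
have /Hy Hgh : coef (g^-1 * h)%g y != 0.
  by apply: contraNneq ch => ->; rewrite mulr0.
by rewrite -(mulVKg g h); exact: (subgroupM sH).
Qed.

Lemma supported1 : supported 1.
Proof. by rewrite -gr1; apply: supported_gr; case: sH. Qed.

Lemma supportedN1 : supported (- 1).
Proof.
have -> : - 1 = gr (- 1) 1%g :> group_ring R G.
  by apply/eqP; rewrite eq_sym -addr_eq0 -gr1 -grD addNr gr0.
by apply: supported_gr; case: sH.
Qed.

Lemma supportedN x : supported x -> supported (- x).
Proof.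
by rewrite -mulN1r => Hx; apply: supportedM => //; exact: supportedN1.
Qed.

Lemma supportedB x y : supported x -> supported y -> supported (x - y).
Proof. by move=> Hx Hy; apply: supportedD => //; exact: supportedN. Qed.

Lemma supportedMn x n : supported x -> supported (x *+ n).
Proof.
move=> Hx; elim: n => [|n IHn]; first by rewrite mulr0n; exact: supported0.
by rewrite mulrS; exact: supportedD.
Qed.

Section Submodule.
Variable L : set (group_ring R G).
Hypothesis sL : left_submod supported L.

Let LD x y : L x -> L y -> L (x + y). Proof. by case: sL => _ + _; apply. Qed.

Let LM x y : supported x -> L y -> L (x * y).
Proof. by case: sL => _ _; apply. Qed.

Lemma submodN x : L x -> L (- x).
Proof. by rewrite -mulN1r; apply: LM; exact: supportedN1. Qed.

Lemma submodB x y : L x -> L y -> L (x - y).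
Proof. by move=> Lx Ly; apply: LD => //; exact: submodN. Qed.

(** The sum of [L] and of the [R g] for [g] in [s]. *)
Fixpoint span (s : seq G) : set (group_ring R G) :=
  if s is g :: s' then [set y | exists c, span s' (y - gr c g)] else L.

Lemma spanD s x y : span s x -> span s y -> span s (x + y).
Proof.
elim: s x y => [|g s IHs] x y /=; first exact: LD.
by move=> [c xc] [d yd]; exists (c + d); rewrite grD opprD addrACA; exact: IHs.
Qed.

Lemma spanZ s c x : span s x -> span s (gr c 1%g * x).
Proof.
elim: s x => [|g s IHs] x /=.
  by apply: LM; apply: supported_gr; case: sH.
move=> [d xd]; exists (c * d).
by have := IHs _ xd; rewrite mulrBr grM mul1g.
Qed.

Lemma sub_span s x : L x -> span s x.
Proof.
by elim: s x => [|g s IHs] x Lx //=; exists 0; rewrite gr0 subr0; exact: IHs.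
Qed.

Lemma spanMn s x n : span s x -> span s (x *+ n).
Proof.
move=> sx; elim: n => [|n IHn]; first by apply: sub_span; rewrite mulr0n; case: sL.
by rewrite mulrS; exact: spanD.
Qed.

Lemma span_supported s x : (forall g, coef g x != 0 -> g \in s) -> span s x.
Proof.
elim: s x => [|g s IHs] x xs /=.
  suff -> : x = 0 by case: sL.
  by apply: (@gr_ind _ _ (fun y => y = 0)) => // [y z -> ->|h /xs //]; rewrite addr0.
exists (coef g x); apply: IHs => h.
rewrite raddfB /= coef_gr; case: (g =P h) => [<-|/eqP gh]; first by rewrite subrr eqxx.
by rewrite subr0 => /xs; rewrite inE eq_sym (negPf gh).
Qed.

(** Nakayama's lemma for the quotient of the group ring of [H] by [L], which is
    generated over [R] by the finitely many elements of [H].  A generator [g]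
    is congruent to a combination with coefficients in [p R]; as [1 - c p] is
    left invertible in [R], [g] is redundant. *)
Lemma nakayama (p : nat) (s : seq G) :
    jacobson_radical R p%:R -> H = [set` s] ->
    (forall x, supported x -> exists2 t, supported t & L (x - t *+ p)) ->
  L 1.
Proof.
move=> /jacobsonP Jp Hs Lp.
suff spanT r : [set` r] `<=` H -> (forall x, supported x -> span r x) ->
    forall x, supported x -> L x.
  apply: (spanT s) => // [|x Hx|]; last exact: supported1.
    by rewrite Hs.
  by apply: span_supported => g /Hx; rewrite Hs.
elim: r => [//|g r IHr] Tr spanT; apply: IHr => [h hr|].
  by apply: Tr; rewrite /= inE hr orbT.
have Hg : H g by apply: Tr; rewrite /= inE eqxx.
have spang : span r (gr 1 g).
  have [t Ht Lt] := Lp _ (supported_gr (c := 1) Hg).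
  have [c tc] := spanT _ Ht; have [d d1] := Jp c.
  suff /(spanZ d) : span r (gr (1 - c * p%:R) g) by rewrite grM mul1g d1.
  have := spanD (sub_span r Lt) (spanMn p tc).
  by rewrite mulrnBl addrA subrK mulr_natr -grMn -grN -grD.
move=> x Hx; have [c xc] := spanT _ Hx.
by rewrite -(subrK (gr c g) x); apply: spanD => //; have := spanZ c spang;
  rewrite grM mulr1 mul1g.
Qed.

(** Otherwise [L + p R[H]] would contain [1] by maximality, hence all of
    [R[H]], and Nakayama's lemma would put [1] in [L]. *)
Lemma max_submod_nat (p : nat) :
    jacobson_radical R p%:R -> finite_set H -> ~ L 1 ->
    (forall L', left_submod supported L' -> L `<=` L' -> ~ L' 1 -> L' `<=` L) ->
  forall x, supported x -> L (x *+ p).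
Proof.
move=> Jp Hfin L1 Lmax x Hx.
pose M := [set z | exists2 t, supported t & L (z - t *+ p)].
have sM : left_submod supported M.
  split; first by exists 0; [exact: supported0|rewrite mul0rn subr0; case: sL].
    move=> y1 y2 [t1 Tt1 L1'] [t2 Tt2 L2']; exists (t1 + t2).
      exact: supportedD.
    by rewrite mulrnDl opprD addrACA; exact: LD.
  move=> a z Ta [t Tt Lt]; exists (a * t); first exact: supportedM.
  by rewrite -mulrnAr -mulrBr; exact: LM.
have LsubM : L `<=` M.
  move=> z Lz; exists 0; first exact: supported0.
  by rewrite mul0rn subr0.
have M1 : ~ M 1.
  move=> M1; have /finite_seqP [s sE] := Hfin.
  apply/L1/(nakayama Jp sE) => z Tz.
  by case: sM => _ _ /(_ _ _ Tz M1); rewrite mulr1.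
by apply: (Lmax M) => //; exists x => //; rewrite subrr; case: sL.
Qed.

End Submodule.

Variable p : nat.
Hypotheses (p_pr : prime p) (Gp : pgroup G p).
Variable L : set (group_ring R G).
Hypotheses (sL : left_submod supported L) (L1 : ~ L 1).
Hypothesis Lp : forall x, supported x -> L (x *+ p).

Let LD x y : L x -> L y -> L (x + y). Proof. by case: sL => _ + _; apply. Qed.

Let LM x y : supported x -> L y -> L (x * y).
Proof. by case: sL => _ _; apply. Qed.

(** The elements of [R[H]] whose class modulo [L] is fixed by [X]. *)
Definition fixed_by (X : set G) : set (group_ring R G) :=
  [set y | supported y /\ forall g, X g -> L (gr 1 g * y - y)].

(** Since [k g = g k [~ k, g]], if [k] and [[~ k, g]] fix [y] modulo [L], then
    [k] fixes [g y]. *)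
Lemma fixed_byM (D X : set G) g y : subgroup D -> D `<=` H -> X `<=` D ->
    derived D `<=` X -> D g ->
  fixed_by X y -> fixed_by X (gr 1 g * y).
Proof.
move=> sD DH XD DX Dg [Hy yX]; split.
  by apply: supportedM => //; apply: supported_gr; exact: DH.
move=> k Xk; have Dk := XD _ Xk.
have Lc : L (gr 1 [~ k, g]%g * y - y) by apply: yX; apply: DX; exact: derived_comm.
have -> : gr 1 k * (gr 1 g * y) - gr 1 g * y
    = gr 1 g * (gr 1 k * (gr 1 [~ k, g]%g * y - y) + (gr 1 k * y - y)).
  rewrite !mulrBr addrA subrK !mulrA !grM !mulr1 mulrBr !mulrA !grM !mulr1.
  by rewrite (commgC k g) !mulgA.
apply: LM; first by apply: supported_gr; exact: DH.
apply: LD; last exact: yX.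
by apply: LM => //; apply: supported_gr; exact: DH.
Qed.

Lemma fixed_byB (X : set G) x y :
  X `<=` H -> fixed_by X x -> fixed_by X y -> fixed_by X (x - y).
Proof.
move=> XH [Hx xX] [Hy yX]; split; first exact: supportedB.
move=> g Xg.
have -> : gr 1 g * (x - y) - (x - y) = gr 1 g * x - x - (gr 1 g * y - y).
  by rewrite mulrBr !opprB [y - x]addrC addrACA [- _ + y]addrC.
by apply: (submodB sL); [exact: xX|exact: yX].
Qed.

(** Modulo [L], where [p] acts as zero, [u ^ p - 1 = (u - 1) ^ p].  So if
    [u = g ^ (p ^ k)] and [u ^ p] fixes [y], the operator [u - 1] is nilpotent
    on [y], and the last nonzero [(u - 1) ^ i y] is fixed by [u].  Descending on
    [k] from the order of [g] reaches [g] itself. *)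
Lemma fixed_by_adjoin (D X : set G) g : subgroup D -> D `<=` H -> X `<=` D ->
    derived D `<=` X -> D g -> (exists2 y, fixed_by X y & ~ L y) ->
  exists2 y, fixed_by (X `|` [set g]) y & ~ L y.
Proof.
move=> sD DH XD DX Dg [y0 Xy0 Ly0].
have XH : X `<=` H by exact: subset_trans DH.
suff [y [Xy Ly gy]] : exists y, [/\ fixed_by X y, ~ L y & L (gr 1 g * y - y)].
  exists y => //; case: Xy => Hy yX; split=> // h [/yX //|-> //].
have [k [_ gk _]] := Gp g.
suff [y [Xy Ly gy]] : exists y,
    [/\ fixed_by X y, ~ L y & L (gr 1 (g ^+ (p ^ 0))%g * y - y)].
  by exists y; rewrite expn0 expg1 in gy.
have : exists y, [/\ fixed_by X y, ~ L y & L (gr 1 (g ^+ (p ^ k))%g * y - y)].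
  exists y0; split=> //; rewrite gk gr1 mul1r subrr; by case: sL.
elim: {gk} k => [//|k IHk] [y [Xy Ly gy]]; apply: IHk.
pose u : group_ring R G := gr 1 (g ^+ (p ^ k))%g; pose t := u - 1.
have Xt z : fixed_by X z -> fixed_by X (t * z).
  move=> Xz; rewrite mulrBl mul1r; apply: fixed_byB => //.
  by apply: (fixed_byM sD) => //; exact: subgroupX.
have XtX i : fixed_by X (t ^+ i * y).
  by elim: i => [|i IHi]; rewrite ?expr0 ?mul1r // exprS -mulrA; exact: Xt.
have Ltp : L (t ^+ p * y).
  pose r := \sum_(i < p.-1) t ^+ i.+1 *+ ('C(p, i.+1) %/ p).
  have -> : t ^+ p * y = u ^+ p * y - y - (r * y) *+ p.
    rewrite -[in RHS](subrK 1 u) -/t exprD1n_prime // !mulrDl mul1r mulrnAl.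
    by rewrite addrAC !addrK.
  apply: (submodB sL); first by rewrite grX -expgnA -expnSr.
  apply: Lp; rewrite mulr_suml; elim/big_ind: _ => [||i _].
  - exact: supported0.
  - exact: supportedD.
  by rewrite mulrnAl; apply: supportedMn; case: (XtX i.+1).
have descend n z : fixed_by X z -> ~ L z -> L (t ^+ n * z) ->
    exists y', [/\ fixed_by X y', ~ L y' & L (u * y' - y')].
  elim: n z => [|n IHn] z Xz Lz; first by rewrite expr0 mul1r.
  have [tz|tz] := pselect (L (t * z)).
    by exists z; split=> //; rewrite mulrBl mul1r in tz.
  by rewrite exprSr -mulrA => /(IHn _ (Xt _ Xz) tz).
exact: (descend p y).
Qed.

Lemma fixed_by_derived (D : set G) : finite_set H -> subgroup D -> D `<=` H ->
    (exists2 y, fixed_by (derived D) y & ~ L y) ->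
  exists2 y, fixed_by D y & ~ L y.
Proof.
move=> Hfin sD DH exy.
have /finite_seqP [s sE] : finite_set D by exact: sub_finite_set Hfin.
suff rP (r : seq G) : [set` r] `<=` D ->
    exists2 y, fixed_by (derived D `|` [set` r]) y & ~ L y.
  have [|y [Hy yX] Ly] := rP s; first by rewrite sE.
  by exists y => //; split=> // g Dg; apply: yX; right; rewrite -sE.
elim: r => [_|g r IHr rD].
  by have -> : [set` [::]] = set0 :> set G; [apply/seteqP; split=> x //|rewrite setU0].
have rD' : [set` r] `<=` D.
  by move=> h hr; apply: rD; rewrite /= inE; apply/orP; right.
have XD : derived D `|` [set` r] `<=` D.
  by move=> h [/(derived_sub sD)|/rD'].
have DX : derived D `<=` derived D `|` [set` r] by left.
have Dg : D g by apply: rD; rewrite /= inE eqxx.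
have [y [Hy yX] Ly] := fixed_by_adjoin sD DH XD DX Dg (IHr rD').
exists y => //; split=> // h [Dh|]; first by apply: yX; left; left.
rewrite /= inE => /orP[/eqP ->|hr]; apply: yX; first by right.
by left; right.
Qed.

(** A finite solvable [p]-group acting on a nonzero module killed by [p] has a
    nonzero fixed vector: one goes up the derived series from the trivial
    subgroup, which fixes [1], adjoining elements one at a time. *)
Lemma fixed_by_solvable (D : set G) : finite_set H -> subgroup D -> D `<=` H ->
    solvable_subgroup D ->
  exists2 y, fixed_by D y & ~ L y.
Proof.
move=> Hfin sD DH [n]; elim: n D sD DH => [|n IHn] D sD DH.
  move=> /= ->; exists 1 => //; split; first exact: supported1.
  by move=> _ ->; rewrite gr1 mul1r subrr; case: sL.
rewrite iterSr => Dn; apply: fixed_by_derived => //.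
apply: IHn => //; first exact: subgroup_generated.
by apply: subset_trans DH; exact: derived_sub.
Qed.

End SubgroupRing.

Section LocallyFinitePGroup.
Variables (R : nzRingType) (G : groupType) (p : nat).
Hypotheses (p_pr : prime p) (Jp : jacobson_radical R p%:R).
Hypotheses (Gsol : locally_solvable G) (Gfin : locally_finite G).
Hypothesis (Gp : pgroup G p).
Implicit Types (x y : group_ring R G).

(** Let [H] be the finite subgroup generated by the support of [x].  If [x] had
    no left inverse in [R[H]], a maximal proper [L] would contain [R[H] x].  The
    elements fixed by [H] modulo [L] form a submodule larger than [L], so [1] is
    fixed: [h - 1] is in [L] for every [h] in [H].  Thus [x - aug x] is in [L],
    and so is [1]. *)
Lemma left_inverse_of_aug1 x : aug x = 1 -> exists y, y * x = 1.
Proof.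
move=> x1; pose A : set G := [set` msupp x].
have Afin : finite_set A by exact: finite_fset.
pose H := generated A; have sH : subgroup H := subgroup_generated A.
have Hfin : finite_set H := Gfin Afin.
pose T := @supported R G H.
have Tx : T x.
  by move=> g; rewrite mcoeff_neq0 => gx; exact: sub_generated.
apply: contrapT => nox; pose L0 := [set y | exists2 t, T t & y = t * x].
have L0sub : left_submod T L0.
  split; first by exists 0; [exact: supported0|rewrite mul0r].
    move=> _ _ [s Ts ->] [t Tt ->]; exists (s + t); last by rewrite mulrDl.
    exact: supportedD.
  move=> a _ Ta [s Ts ->]; exists (a * s); last by rewrite mulrA.
  exact: supportedM.
have [|L [sL L0L L1 Lmax]] := max_left_submod L0sub.
  by case=> s _ s1; apply: nox; exists s.
have [L_0 LD LM] := sL.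
have Lp := max_submod_nat sH sL Jp Hfin L1 Lmax.
have [y [Ty yH] Ly] :=
  fixed_by_solvable sH p_pr Gp sL L1 Lp Hfin sH (fun _ h => h) (Gsol Afin).
pose W := [set z | forall h, H h -> L (gr 1 h * z - z)].
have sW : left_submod T W.
  have WD z1 z2 : W z1 -> W z2 -> W (z1 + z2).
    move=> W1 W2 h Hh; rewrite mulrDr opprD addrACA.
    by apply: LD; [exact: W1|exact: W2].
  have W0 : W 0 by move=> h _; rewrite mulr0 subrr.
  split=> // a z Ta Wz; move: Ta; apply: (@supported_ind _ _ _ (fun b => W (b * z))).
  - by rewrite mul0r.
  - by move=> a1 a2 W1 W2; rewrite mulrDl; exact: WD.
  move=> c g Hg h Hh.
  have -> : gr 1 h * (gr c g * z) - gr c g * z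
      = gr c 1%g * (gr 1 (h * g)%g * z - z - (gr 1 g * z - z)).
    rewrite opprB addrA subrK mulrBr !mulrA !grM.
    by rewrite !mulr1 !mul1r !mul1g.
  apply: LM; first by apply: supported_gr; case: sH.
  apply: (submodB sH sL); apply: Wz => //; exact: (subgroupM sH).
have LW : L `<=` W.
  move=> z Lz h Hh; apply: (submodB sH sL) => //; apply: LM => //.
  exact: supported_gr.
have W1 : W 1 by apply: contrapT => /(Lmax _ sW LW); move=> /(_ y yH).
have Laug a : T a -> L (a - gr (aug a) 1%g).
  apply: (@supported_ind _ _ _ (fun b => L (b - gr (aug b) 1%g))).
  - by rewrite raddf0 gr0 subrr.
  - move=> a1 a2 La1 La2; rewrite raddfD /= grD opprD addrACA; exact: LD.
  move=> c g Hg; rewrite aug_gr.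
  have -> : gr c g - gr c 1%g = gr c 1%g * (gr 1 g * 1 - 1).
    by rewrite !mulr1 mulrBr mulr1 grM mulr1 mul1g.
  by apply: LM; [apply: supported_gr; case: sH|exact: W1].
apply: L1; rewrite -[1](subrK x); apply: LD.
  by have /(submodN sH sL) := Laug x Tx; rewrite x1 gr1 opprB.
apply: L0L; exists 1; rewrite ?mul1r //; exact: supported1.
Qed.

(** A left inverse of [x] has augmentation [1] too, so it is left invertible. *)
Lemma unit_of_aug1_pgroup x : aug x = 1 -> units _ x.
Proof.
move=> x1; have [y yx] := left_inverse_of_aug1 x1.
have y1 : aug y = 1.
  by have := congr1 (@aug R G) yx; rewrite rmorphM rmorph1 /= x1 mulr1.
have [z zy] := left_inverse_of_aug1 y1.
exists y; split=> //.
by have -> : x = z by rewrite -[LHS]mul1r -zy -mulrA yx mulr1.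
Qed.

End LocallyFinitePGroup.

Theorem corollary4p4 (R : nzRingType) (G : groupType)
    (Gnontrivial : exists g : G, g <> 1%g) (Gsol : locally_solvable G) :
  UsqrtDelta_ring (group_ring R G) <->
  (UsqrtDelta_ring R /\
   exists p : nat,
     [/\ prime p, jacobson_radical R (p%:R), locally_finite G & pgroup G p]).
Proof.
split; first exact: UsqrtDelta_group_ring_necessary.
move=> [RU [p [p_pr Jp Gfin Gp]]]; apply: UsqrtDelta_ring_group_ring RU.
exact: (unit_of_aug1_pgroup p_pr Jp Gsol Gfin Gp).
Qed.
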